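(* Let $u_h^0,u_h^1,\dots,u_h^N\in V^k_{0,h}$ be a solution of the CN-L1-NIPG fully discrete scheme, i.e. for every $0\leq n\leq N-1$ and every $v_h\in V^k_{0,h}$, $$\lambda_1\left(\frac{u_h^{n+1}-u_h^{n}}{\tau},v_h\right)+\lambda_2\left({}_{L1}\mathrm{D}^{\alpha}_{n+\frac12}u_h,v_h\right)+B_h\left(u_h^{n+\frac12},v_h\right)=\left(f^{n+\frac12},v_h\right).$$ Then for all $0\leq n\leq N-1$, $$\|u_h^{n+1}\|^2\leq\left(1+\frac{\lambda_2}{\lambda_1}\,\omega_{2-\alpha}(t_{n+1})\right)\|u_h^0\|^2+\frac{\tau}{2\lambda_1\gamma_2}\sum_{j=0}^{n}\left\|f^{j+\frac12}\right\|^2 .$$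
   Context: Constants: $\alpha\in(0,1)$, $L,T>0$, $\lambda_1,\lambda_2,\gamma_1,\gamma_2>0$; $\Omega=(0,L)$; $f\in C^0([0,T];L^2(\Omega))$. Write $\omega_\beta(t)=t^{\beta-1}/\Gamma(\beta)$ for $\beta>0$, with $\omega_{2-\alpha}(0)=0$. The scheme discretizes the problem $\lambda_1 u_t+\lambda_2\,{}_C\mathrm{D}^\alpha_{0,t}u-\gamma_1u_{xx}+\gamma_2u=f$ on $\Omega\times(0,T]$ with $u(x,0)=\phi(x)$ and $u(0,t)=u(L,t)=0$, where ${}_C\mathrm{D}^\alpha_{0,t}$ is the Caputo derivative in time. Space mesh: $M\in\mathbb N$, $h=L/M$, $x_m=mh$ ($0\leq m\leq M$), $K_m=(x_m,x_{m+1})$ ($0\leq m\leq M-1$). For a fixed integer $k\geq1$, $V^k_{0,h}$ is the space of $w\in L^2(\Omega)$ whose restriction to each $K_m$ is a polynomial of degree at most $k$ and which vanish on $\partial\Omega=\{0,L\}$ (no continuity at interior nodes is required). At interior nodes, $w_m^\pm=w(x_m\pm0)$, jump $[w]_m=w_m^+-w_m^-$, average $\{w\}_m=\frac12(w_m^++w_m^-)$. Jumps at $m=0$ and $m=M$ are zero for functions vanishing on $\partial\Omega$, so the boundary terms in the sums below vanish. $(w_1,w_2)=\sum_{m=0}^{M-1}\int_{K_m}w_1w_2\,dx$ and $\|\cdot\|$ is the $L^2(\Omega)$ norm. Bilinear form: with penalty parameters $\varsigma_m>0$ and derivatives taken elementwise, $$B_h(w,v)=\gamma_1\left(\tfrac{\partial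 w}{\partial x},\tfrac{\partial v}{\partial x}\right)+\gamma_2(w,v)+\gamma_1\sum_{m=0}^{M}\left(\left\{\tfrac{\partial w}{\partial x}\right\}_m[v]_m-\left\{\tfrac{\partial v}{\partial x}\right\}_m[w]_m\right)+\sum_{m=0}^{M}\frac{\varsigma_m}{h}[w]_m[v]_m .$$ Time mesh: $N\in\mathbb N$, $\tau=T/N$, $t_n=n\tau$. For a sequence $(v^n)$ (in particular $v^n=v(t_n)$ for a function $v$ of time), $v^{n+\frac12}=\frac12(v^n+v^{n+1})$; thus $f^{n+\frac12}=\frac12(f(\cdot,t_n)+f(\cdot,t_{n+1}))$. Set $$d_j=\tau^{-\alpha}\left[\omega_{2-\alpha}(j)-\omega_{2-\alpha}(j-1)\right],\qquad j\geq1,$$ $${}_{L1}\mathrm{D}^{\alpha}_{n+\frac12}v=\sum_{j=1}^{n}d_j\left(v^{n-j+\frac32}-v^{n-j+\frac12}\right)+\frac{d_{n+1}}{2}(v^1-v^0),\qquad 0\leq n\leq N-1,$$ (empty sum for $n=0$). *)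

(* Defs.v *)
From HB Require Import structures.
From mathcomp Require Import all_boot all_order all_algebra.
From mathcomp Require Import all_classical all_reals all_analysis.

Set Implicit Arguments.
Unset Strict Implicit.
Unset Printing Implicit Defensive.

Import Order.TTheory GRing.Theory Num.Theory.
Import numFieldNormedType.Exports.

Local Open Scope classical_set_scope.
Local Open Scope ring_scope.

Definition Gamma (R : realType) (b : R) : R :=
  \int[lebesgue_measure]_(t in `]0, +oo[) (t `^ (b - 1) * expR (- t)).

(* Since 0 `^ r = 0 for r != 0, omega b 0 = 0 whenever b != 1; in particular
   this gives the convention omega (2 - alpha) 0 = 0 for alpha < 1. *)
Definition omega (R : realType) (b t : R) : R := t `^ (b - 1) / Gamma b.

Definition Omega (R : realType) (L : R) : set R := `]0, L[.

(* Elements of L^2(Omega) are represented by functions on the whole line, of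
   which only the values on Omega matter: w \_ Omega L is w on Omega L and 0
   elsewhere. *)
Definition L2 (R : realType) (L : R) (w : R -> R) : Prop :=
  w \_ (Omega L) \in Lfun lebesgue_measure 2%:E.

Definition L2norm (R : realType) (L : R) (w : R -> R) : R :=
  fine ('N[lebesgue_measure]_2%:E[EFin \o (w \_ (Omega L))])%E.

Definition C0_L2 (R : realType) (L T : R) (f : R -> R -> R) : Prop :=
  (forall t : R, 0 <= t <= T -> L2 L (f t)) /\
  forall s : R, 0 <= s <= T ->
    L2norm L (f t \- f s) @[t --> within `[0, T] (nbhs s)] --> (0 : R).

Definition mesh_size (R : realType) (L : R) (M : nat) : R := L / M%:R.

Definition node (R : realType) (L : R) (M m : nat) : R :=
  m%:R * mesh_size L M.

Definition cell (R : realType) (L : R) (M m : nat) : set R :=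
  `]node L M m, node L M m.+1[.

(* Each class in V^k_{0,h} is represented by functions that are polynomial on
   the open cells, have arbitrary values at the interior nodes (which no
   quantity below depends on), and are extended by 0 outside Omega. Vanishing
   on the boundary is vanishing of the traces of w from inside Omega. *)
Definition dg_space (R : realType) (L : R) (M k : nat) (w : R -> R) : Prop :=
  [/\ L2 L w,
      forall m, (m < M)%N -> exists p : {poly R},
        (size p <= k.+1)%N /\ (forall x, cell L M m x -> w x = p.[x]),
      forall x, x \notin Omega L -> w x = 0,
      w x @[x --> (0 : R)^'+] --> (0 : R) &
      w x @[x --> L^'-] --> (0 : R)].

Definition trace_right (R : realType) (L : R) (M m : nat) (w : R -> R) : R :=
  lim (w x @[x --> (node L M m)^'+]).

Definition trace_left (R : realType) (L : R) (M m : nat) (w : R -> R) : R :=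
  lim (w x @[x --> (node L M m)^'-]).

(* At m = 0 and m = M the outer trace is that of the extension by 0, so that
   both boundary jumps are 0 on dg_space. *)
Definition jump (R : realType) (L : R) (M m : nat) (w : R -> R) : R :=
  trace_right L M m w - trace_left L M m w.

Definition average (R : realType) (L : R) (M m : nat) (w : R -> R) : R :=
  (trace_left L M m w + trace_right L M m w) / 2.

Definition inner (R : realType) (L : R) (M : nat) (w v : R -> R) : R :=
  \sum_(m < M) \int[lebesgue_measure]_(x in cell L M m) (w x * v x).

(* The derivative derive1 w is only used inside the cells or through one-sided
   limits at the nodes, i.e. elementwise. *)
Definition nipg_form (R : realType) (L : R) (M : nat) (gamma1 gamma2 : R)
    (sigma : nat -> R) (w v : R -> R) : R :=
  gamma1 * inner L M (derive1 w) (derive1 v) + gamma2 * inner L M w v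
  + gamma1 * \sum_(m < M.+1) (average L M m (derive1 w) * jump L M m v
                              - average L M m (derive1 v) * jump L M m w)
  + \sum_(m < M.+1) sigma m / mesh_size L M * jump L M m w * jump L M m v.

Definition time_step (R : realType) (T : R) (N : nat) : R := T / N%:R.

Definition time_node (R : realType) (T : R) (N n : nat) : R :=
  n%:R * time_step T N.

(* midpoint v n is v^{n + 1/2} *)
Definition midpoint (R : realType) (V : lmodType R) (v : nat -> V) (n : nat)
    : V :=
  (2^-1 : R) *: (v n + v n.+1).

Definition l1_coef (R : realType) (alpha tau : R) (j : nat) : R :=
  tau `^ (- alpha) * (omega (2 - alpha) j%:R - omega (2 - alpha) (j%:R - 1)).

Definition l1_caputo (R : realType) (V : lmodType R) (alpha tau : R)
    (v : nat -> V) (n : nat) : V :=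
  \sum_(1 <= j < n.+1)
     l1_coef alpha tau j *: (midpoint v (n - j).+1 - midpoint v (n - j))
  + (l1_coef alpha tau n.+1 / 2) *: (v 1%N - v 0%N).

Definition cn_l1_nipg_solution (R : realType)
    (alpha L T lambda1 lambda2 gamma1 gamma2 : R) (M N k : nat)
    (sigma : nat -> R) (f : R -> R -> R) (u : nat -> R -> R) : Prop :=
  let tau := time_step T N in
  let fn := fun n => f (time_node T N n) in
  (forall n, (n <= N)%N -> dg_space L M k (u n)) /\
  forall n, (n < N)%N -> forall v : R -> R, dg_space L M k v ->
    lambda1 * inner L M (tau^-1 *: (u n.+1 - u n)) v
    + lambda2 * inner L M (l1_caputo alpha tau u n) v
    + nipg_form L M gamma1 gamma2 sigma (midpoint u n) v
    = inner L M (midpoint fn n) v.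

(* Main.v *)
(* Test the scheme with w^n = u^(n+1/2). The consistency terms of the NIPG form
   cancel on the diagonal, so B_h(w^n, w^n) >= gamma_2 |w^n|^2, which absorbs
   the source term by Young's inequality; the first difference gives
   (|u^(n+1)|^2 - |u^n|^2) / (2 tau). Since (u^1 - u^0) / 2 = w^0 - u^0, the
   discrete Caputo derivative is the plain L1 convolution of the differences of
   (u^0, w^0, w^1, ...), with coefficients d_j that are nonnegative and
   nonincreasing because t^(1 - alpha) is concave. Hence its product with w^n is
   at least half the same convolution applied to the squared norms q_i. Summing
   over n telescopes that convolution to sum_i d_i (q_(n+1-i) - q_0), which is
   at least - q_0 sum_i d_i = - q_0 tau^(-alpha) omega_(2-alpha)(n+1). *)

Require Import Defs.
From mathcomp Require Import all_boot all_order all_algebra.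
From mathcomp Require Import all_classical all_reals all_analysis.
From mathcomp Require Import zify ring lra.

Set Implicit Arguments.
Unset Strict Implicit.
Unset Printing Implicit Defensive.

Import Order.TTheory GRing.Theory Num.Theory.
Import numFieldNormedType.Exports.

Local Open Scope classical_set_scope.
Local Open Scope ring_scope.

(** * The L1 weights: sign, monotonicity, sum, and a discrete chain rule *)

Section L1_kernel.
Variable R : realType.
Implicit Types (alpha b tau x y : R) (d c k q : nat -> R).

(** Young's inequality with conjugate exponents 1/b and 1/(1 - b), applied to y^b and x^(1 - b). *)
Lemma weighted_amgm b x y : 0 < b -> b < 1 -> 0 < x -> 0 <= y ->
  y `^ b * x `^ (1 - b) <= b * y + (1 - b) * x.
Proof.
move=> b0 b1 x0 y0; have b'0 : 0 < 1 - b by rewrite subr_gt0.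
have := @conjugate_powR R (y `^ b) (x `^ (1 - b)) b^-1 (1 - b)^-1.
rewrite -!powRrM !mulfV ?gt_eqF// !powRr1 ?(ltW x0)// !invrK.
rewrite [y * b]mulrC [x * _]mulrC; apply; rewrite ?powR_ge0 ?invr_gt0//.
by rewrite subrKC.
Qed.

(** After multiplication by x^(1 - b) the middle power becomes x, and [weighted_amgm] bounds the
    outer two by b (x + 1) + (1 - b) x and b (x - 1) + (1 - b) x, whose sum is 2 x. *)
Lemma powR_midpoint_concave b x : 0 < b -> b < 1 -> 1 <= x ->
  (x + 1) `^ b - x `^ b <= x `^ b - (x - 1) `^ b.
Proof.
move=> b0 b1 x1; have x0 : 0 < x by rewrite (lt_le_trans ltr01).
have xM0 : 0 <= x - 1 by rewrite subr_ge0.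
have xP0 : 0 <= x + 1 by rewrite addr_ge0// ltW.
have h1 := weighted_amgm b0 b1 x0 xP0; have h2 := weighted_amgm b0 b1 x0 xM0.
have p0 : 0 < x `^ (1 - b) by rewrite powR_gt0.
have hx : x `^ b * x `^ (1 - b) = x.
  by rewrite -powRD ?subrKC ?powRr1 ?ltW// gt_eqF ?implybT.
rewrite -(ler_pM2r p0) !mulrBl hx.
move: h1 h2; nra.
Qed.

(** The weak inequality suffices for division by [Gamma b] to be monotone, since the inverse of 0 is
    0. *)
Lemma Gamma_ge0 b : 0 <= Gamma b.
Proof.
by apply: Rintegral_ge0 => t _; rewrite mulr_ge0 ?powR_ge0 ?expR_ge0.
Qed.

Lemma omega0 alpha : alpha < 1 -> omega (2 - alpha) 0 = 0.
Proof. by move=> a1; rewrite /omega powR0 ?mul0r// gt_eqF//; lra. Qed.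

Lemma l1_coef_ge0 alpha tau j : alpha < 1 -> 0 <= l1_coef alpha tau j.+1.
Proof.
move=> a1; rewrite mulr_ge0 ?powR_ge0// subr_ge0.
rewrite ler_wpM2r ?invr_ge0 ?Gamma_ge0//.
by rewrite -natr1 addrK; apply: ge0_ler_powR; rewrite ?nnegrE ?lerDl//; lra.
Qed.

Lemma l1_coef_nonincreasing alpha tau j : 0 < alpha -> alpha < 1 ->
  l1_coef alpha tau j.+2 <= l1_coef alpha tau j.+1.
Proof.
move=> a0 a1; rewrite ler_wpM2l ?powR_ge0// /omega -!mulrBl.
rewrite ler_wpM2r ?invr_ge0 ?Gamma_ge0// -[j.+2%:R]natr1 addrK.
by apply: powR_midpoint_concave; [lra|lra|rewrite ler1n].
Qed.

Lemma sum_l1_coef alpha tau n : alpha < 1 ->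
  \sum_(i < n) l1_coef alpha tau i.+1 =
  tau `^ (- alpha) * omega (2 - alpha) n%:R.
Proof.
move=> a1; elim: n => [|n IH]; first by rewrite big_ord0 omega0 ?mulr0.
by rewrite big_ord_recr/= IH /l1_coef -[n.+1%:R]natr1 addrK -mulrDr subrKC.
Qed.

Lemma sum_by_parts_ge0 d k n :
    (forall i, 0 <= d i) -> (forall i, d i.+1 <= d i) ->
    k 0%N = 0 -> (forall i, (i <= n)%N -> 0 <= k i) ->
  0 <= \sum_(i < n) d i * (k i.+1 - k i).
Proof.
move=> d0 dS k0 kge0; case: n kge0 => [|n] kge0; first by rewrite big_ord0.
(* Abel summation as an induction: replacing [d m] by the smaller [d m.+1] in front of [k m.+1]
   cancels the subtracted half of the next term. *)
suff h m : (m <= n)%N -> d m * k m.+1 <= \sum_(i < m.+1) d i * (k i.+1 - k i).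
  by apply: le_trans (h n (leqnn n)); rewrite mulr_ge0// kge0.
elim: m => [_|m IH mn]; first by rewrite big_ord1 k0 subr0.
rewrite big_ord_recr/= mulrBr -lerBlDr opprB addrC subrK.
by apply: le_trans (IH (ltnW mn)); rewrite ler_wpM2r ?kge0// ltnW.
Qed.

(* The [k] to which [sum_by_parts_ge0] applies is
   [q n.+1 / 2 - (c i - q i / 2)] read backwards from [i = n.+1]. *)
Lemma discrete_chain_rule d c q n :
    (forall i, 0 <= d i) -> (forall i, d i.+1 <= d i) ->
    c n.+1 = q n.+1 ->
    (forall i, (i <= n)%N -> c i <= (q i + q n.+1) / 2) ->
  2^-1 * \sum_(i < n.+1) d i * (q (n.+1 - i)%N - q (n - i)%N) <=
  \sum_(i < n.+1) d i * (c (n.+1 - i)%N - c (n - i)%N).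
Proof.
move=> d0 dS cq cle; rewrite -subr_ge0.
pose g i := q n.+1 / 2 - (c i - q i / 2).
have g0 i : (i <= n)%N -> 0 <= g i by move=> /cle; rewrite /g; lra.
have := @sum_by_parts_ge0 d (fun i => g (n.+1 - i)%N) n.+1 d0 dS.
rewrite mulr_sumr -sumrB => h.
under eq_bigr => i _.
  rewrite (_ : _ - _ = d i * (g (n.+1 - i.+1)%N - g (n.+1 - i)%N)); last first.
    rewrite /g subSS; lra.
  over.
apply: h; first by rewrite subn0 /g cq; lra.
case=> [_|i _]; first by rewrite subn0 /g cq; lra.
by apply: g0; rewrite subSS leq_subr.
Qed.

(** For a fixed lag i, [d i] multiplies consecutive increments of [q], which collapse over m to
    [q (n - i) - q 0]. *)
Lemma double_sum_telescope d q n :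
  \sum_(m < n) \sum_(i < m.+1) d i * (q (m.+1 - i)%N - q (m - i)%N) =
  \sum_(i < n) d i * (q (n - i)%N - q 0%N).
Proof.
elim: n => [|n IH]; first by rewrite !big_ord0.
rewrite big_ord_recr/= IH [X in _ + X]big_ord_recr.
rewrite [RHS]big_ord_recr/= subnn addrA.
congr (_ + _); rewrite -big_split/=; apply: eq_bigr => i _; lra.
Qed.

End L1_kernel.

(** * The cellwise inner product as the inner product of L^2 *)

Section broken_inner_product.
Variables (R : realType) (L : R) (M : nat).
Hypotheses (L_gt0 : 0 < L) (M_gt0 : (0 < M)%N).
Implicit Types (a : R) (w v z g : R -> R).

Notation mu := (@lebesgue_measure R).
Notation ip := (inner L M).

Lemma node_last : node L M M = L.
Proof. by rewrite /node /mesh_size mulrC divfK// pnatr_eq0 -lt0n. Qed.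

Lemma le_node m n : (m <= n)%N -> node L M m <= node L M n.
Proof. by move=> mn; rewrite ler_wpM2r ?ler_nat// divr_ge0// ltW. Qed.

Lemma sum_cell_Rintegral g :
  mu.-integrable (Omega L) (EFin \o g) ->
  \sum_(m < M) \int[mu]_(x in cell L M m) g x = \int[mu]_(x in Omega L) g x.
Proof.
rewrite /Omega => ig; rewrite -[in RHS]node_last.
suff h n : (n <= M)%N ->
    \sum_(m < n) \int[mu]_(x in cell L M m) g x =
    \int[mu]_(x in `]0, node L M n[) g x by exact: h.
elim: n => [_|n IH nM].
  by rewrite big_ord0 /node mul0r set_itvoo0 Rintegral_set0.
rewrite big_ord_recr/= IH ?(ltnW nM)//.
have ig' : mu.-integrable `]0, node L M n.+1[ (EFin \o g).
  apply: integrableS ig => //; apply: subset_itvl.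
  by rewrite bnd_simp -[leRHS]node_last le_node.
have n0 : 0 <= node L M n.
  by rewrite -[0](mul0r (mesh_size L M)) (le_node (leq0n n)).
have nS : node L M n < node L M n.+1.
  by rewrite ltr_pM2r ?ltr_nat// divr_gt0// ltr0n.
(* The cell is the difference of the intervals from 0 to x_(n+1) and from 0 to x_n, the latter
   closed at x_n; closing it adds only a null set. *)
rewrite /cell -[X in _ + X](@Rintegral_itvB _ g (BRight 0)) ?bnd_simp//.
rewrite (@Rintegral_itv_bndo_bndc _ _ (node L M n)) ?subrKC//.
by apply: integrableS ig' => //; apply: subset_itvl; rewrite bnd_simp ltW.
Qed.

Lemma scaleDE a w v x : (a *: w + v) x = a * w x + v x.
Proof. by []. Qed.

Lemma L2_scaleD a w v : L2 L w -> L2 L v -> L2 L (a *: w + v).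
Proof.
rewrite /L2 => Lw Lv; have le12 : (1 <= 2%:E :> \bar R)%E by rewrite lee1n.
rewrite (_ : _ \_ _ = a *: (w \_ (Omega L)) + v \_ (Omega L)).
  exact: (@Lfun_submod_closed _ _ R mu _ le12).2.
apply/funext => x; rewrite scaleDE !patchE scaleDE.
by case: ifP => // _; rewrite mulr0 addr0.
Qed.

Lemma L2_mul_integrable w v : L2 L w -> L2 L v ->
  mu.-integrable setT (EFin \o ((w \_ (Omega L)) \* (v \_ (Omega L)))).
Proof. by move=> Lw Lv; apply/Lfun1_integrable/Lfun2_mul_Lfun1. Qed.

(** Products of L^2 functions are integrable, so the cells merge into one integral over the line.
    Linearity and the link with [L2norm] are derived from this form. *)
Lemma innerE w v : L2 L w -> L2 L v ->
  ip w v = \int[mu]_x ((w \_ (Omega L)) x * (v \_ (Omega L)) x).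
Proof.
move=> Lw Lv; have ig := L2_mul_integrable Lw Lv.
have wvE : (w \_ (Omega L)) \* (v \_ (Omega L)) = (w \* v) \_ (Omega L).
  by apply/funext => x /=; rewrite !patchE/=; case: ifP => //; rewrite mulr0.
rewrite [RHS](_ : _ = \int[mu]_x ((w \* v) \_ (Omega L)) x);
  last by rewrite -wvE.
rewrite -Rintegral_mkcond -sum_cell_Rintegral//.
apply/(integrable_mkcond _ _).2; first exact: measurable_itv.
by rewrite restrict_EFin -wvE.
Qed.

Lemma innerC w v : ip w v = ip v w.
Proof. by apply: eq_bigr => m _; apply: eq_Rintegral => x _; rewrite mulrC. Qed.

Lemma inner_ge0 w : 0 <= ip w w.
Proof.
by apply: sumr_ge0 => m _; apply: Rintegral_ge0 => x _; rewrite -expr2 sqr_ge0.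
Qed.

Lemma inner_linearl a w v z : L2 L w -> L2 L v -> L2 L z ->
  ip (a *: w + v) z = a * ip w z + ip v z.
Proof.
move=> Lw Lv Lz; rewrite !innerE//; last exact: L2_scaleD.
rewrite -RintegralZl//; last exact: L2_mul_integrable.
rewrite -RintegralD//; last exact: L2_mul_integrable.
  apply: eq_Rintegral => x _; rewrite !patchE.
  by case: ifP => // _; rewrite ?mul0r ?mulr0 ?addr0// mulrDl mulrA.
rewrite (_ : _ \o _ =
  (fun x => a%:E * ((w \_ (Omega L)) x * (z \_ (Omega L)) x)%:E)%E)//.
by apply: integrableZl => //; exact: L2_mul_integrable.
Qed.

Lemma L2_0 : L2 L 0.
Proof.
rewrite /L2; have le12 : (1 <= 2%:E :> \bar R)%E by rewrite lee1n.
rewrite (_ : _ \_ _ = 0); first exact: (@Lfun_submod_closed _ _ R mu _ le12).1.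
by apply/funext => x; rewrite patchE; case: ifP.
Qed.

Lemma L2_D w v : L2 L w -> L2 L v -> L2 L (w + v).
Proof. by move=> Lw Lv; rewrite -[w]scale1r; exact: L2_scaleD. Qed.

Lemma L2_Z a w : L2 L w -> L2 L (a *: w).
Proof. by move=> Lw; rewrite -[_ *: _]addr0; exact: (L2_scaleD _ _ L2_0). Qed.

Lemma L2_B w v : L2 L w -> L2 L v -> L2 L (w - v).
Proof. by move=> Lw Lv; rewrite -scaleN1r; apply: L2_D => //; exact: L2_Z. Qed.

Lemma innerDl w v z : L2 L w -> L2 L v -> L2 L z ->
  ip (w + v) z = ip w z + ip v z.
Proof.
by move=> Lw Lv Lz; rewrite -[X in X + v]scale1r inner_linearl// mul1r.
Qed.

Lemma inner0l z : L2 L z -> ip 0 z = 0.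
Proof.
by move=> Lz; have := innerDl L2_0 L2_0 Lz; rewrite addr0; lra.
Qed.

Lemma innerZl a w z : L2 L w -> L2 L z -> ip (a *: w) z = a * ip w z.
Proof.
move=> Lw Lz; rewrite -[_ *: _]addr0 inner_linearl ?inner0l ?addr0//.
exact: L2_0.
Qed.

Lemma innerBl w v z : L2 L w -> L2 L v -> L2 L z ->
  ip (w - v) z = ip w z - ip v z.
Proof.
move=> Lw Lv Lz; rewrite -scaleN1r innerDl ?innerZl ?mulN1r//.
exact: L2_Z.
Qed.

(** Membership of the partial sums in L^2 is carried through the induction because [innerDl]
    requires it at each step. *)
Lemma inner_suml n (w : nat -> R -> R) z :
    (forall i, (i < n)%N -> L2 L (w i)) -> L2 L z ->
  L2 L (\sum_(i < n) w i) /\ ip (\sum_(i < n) w i) z = \sum_(i < n) ip (w i) z.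
Proof.
elim: n => [|n IH] Lw Lz.
  by rewrite !big_ord0 inner0l//; split=> //; exact: L2_0.
have [|Ls sE] := IH _ Lz; first by move=> i /ltnW; exact: Lw.
rewrite !big_ord_recr/= innerDl ?sE//; last exact: Lw.
by split=> //; apply: L2_D => //; exact: Lw.
Qed.

(** Expand |w - 2 e v|^2 >= 0 and divide by 4 e. *)
Lemma inner_young e w v : 0 < e -> L2 L w -> L2 L v ->
  ip w v <= e * ip v v + ip w w / (4 * e).
Proof.
move=> e0 Lw Lv; have Lev : L2 L ((2 * e) *: v) by exact: L2_Z.
have := inner_ge0 (w - (2 * e) *: v).
have Ld : L2 L (w - (2 * e) *: v) by exact: L2_B.
rewrite innerBl// ![ip _ (w - _)]innerC !innerBl// [ip w (_ *: v)]innerC.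
rewrite !innerZl// [ip v (_ *: v)]innerC innerZl// [ip v w]innerC => h.
have e4 : 0 < 4 * e by rewrite mulr_gt0.
rewrite -(ler_pM2r e4) [leRHS]mulrDl divfK ?gt_eqF//.
nra.
Qed.

Lemma L2norm_sqr w : L2 L w -> L2norm L w ^+ 2 = ip w w.
Proof.
move=> Lw; rewrite innerE// /L2norm -powR_mulrn ?fine_ge0 ?Lnorm_ge0//.
rewrite -fine_poweR poweR_Lnorm//; congr fine; apply: eq_integral => x _ /=.
by rewrite powR_mulrn// real_normK ?num_real// expr2.
Qed.

End broken_inner_product.

(** * Coercivity of the NIPG form and the discrete Caputo term tested with the midpoint *)

Section scheme.
Variables (R : realType) (L : R) (M : nat).
Hypotheses (L_gt0 : 0 < L) (M_gt0 : (0 < M)%N).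
Implicit Types (alpha tau : R) (w v : R -> R).

Notation ip := (inner L M).

Lemma dg_space_scaleD k a w v :
  dg_space L M k w -> dg_space L M k v -> dg_space L M k (a *: w + v).
Proof.
move=> [Lw pw zw w0 wL] [Lv pv zv v0 vL]; split.
- exact: L2_scaleD.
- move=> m mM; have [p [sp wp]] := pw m mM; have [r [sr vr]] := pv m mM.
  exists (a *: p + r); split=> [|x xm].
    rewrite (leq_trans (size_polyD _ _))// geq_max sr andbT.
    exact: leq_trans (size_scale_leq _ _) sp.
  by rewrite scaleDE hornerD hornerZ wp// vr.
- by move=> x xO; rewrite scaleDE zw// zv// mulr0 addr0.
- rewrite -[X in _ --> X]addr0 -[X in _ --> X + _](mulr0 a).
  by apply: cvgD => //; apply: cvgM => //; exact: cvg_cst.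
- rewrite -[X in _ --> X]addr0 -[X in _ --> X + _](mulr0 a).
  by apply: cvgD => //; apply: cvgM => //; exact: cvg_cst.
Qed.

Lemma dg_space_L2 k w : dg_space L M k w -> L2 L w.
Proof. by case. Qed.

Lemma dg_space0 k : dg_space L M k 0.
Proof.
split=> //; first exact: L2_0.
- by move=> m _; exists 0; rewrite size_poly0; split=> // x _; rewrite horner0.
- exact: cvg_cst.
- exact: cvg_cst.
Qed.

Lemma dg_space_midpoint k (u : nat -> R -> R) n :
  dg_space L M k (u n) -> dg_space L M k (u n.+1) ->
  dg_space L M k (midpoint u n).
Proof.
move=> un uS; rewrite /midpoint -[X in dg_space _ _ _ X]addr0.
apply: dg_space_scaleD; last exact: dg_space0.
by rewrite -[X in X + _]scale1r; exact: dg_space_scaleD.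
Qed.

(* The antisymmetric consistency terms cancel on the diagonal. *)
Lemma nipg_form_coercive (gamma1 gamma2 : R) (sigma : nat -> R) w :
    0 <= gamma1 -> (forall m, (m <= M)%N -> 0 <= sigma m) ->
  gamma2 * ip w w <= nipg_form L M gamma1 gamma2 sigma w w.
Proof.
move=> g0 s0; rewrite /nipg_form [X in _ + gamma1 * X]big1; last first.
  by move=> m _; rewrite subrr.
rewrite mulr0 addr0 -addrA addrCA lerDl addr_ge0 ?mulr_ge0 ?inner_ge0//.
apply: sumr_ge0 => m _; rewrite -mulrA mulr_ge0 -?expr2 ?sqr_ge0//.
apply: divr_ge0; first by apply: s0; rewrite -ltnS.
by apply: divr_ge0; [exact: ltW|exact: ler0n].
Qed.

(* The initial value followed by the midpoints: with respect to this shifted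
   sequence [l1_caputo] is a plain L1 convolution, its last term being
   [d_(n+1) (v^(1/2) - v^0)]. *)
Definition shifted_midpoint (V : lmodType R) (v : nat -> V) (i : nat) : V :=
  if i is j.+1 then midpoint v j else v 0%N.

Lemma l1_caputoE (V : lmodType R) alpha tau (v : nat -> V) n :
  l1_caputo alpha tau v n =
  \sum_(i < n.+1) l1_coef alpha tau i.+1 *:
    (shifted_midpoint v (n.+1 - i)%N - shifted_midpoint v (n - i)%N).
Proof.
rewrite big_ord_recr/= subnn subSn// subnn /l1_caputo big_add1/= big_mkord.
congr (_ + _).
  apply: eq_bigr => i _; rewrite subSn; last exact: ltnW.
  by rewrite -(subnSK (ltn_ord i)).
rewrite -scalerA; congr (_ *: _); rewrite /midpoint scalerBr scalerDr/=.
rewrite -addrA [RHS]addrC -addrA; congr (_ + _).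
by rewrite -[X in - X + _]scale1r -!scaleNr -scalerDl; congr (_ *: _); lra.
Qed.

Lemma inner_l1_caputo alpha tau (v : nat -> R -> R) z n :
    (forall i, (i <= n.+1)%N -> L2 L (shifted_midpoint v i)) -> L2 L z ->
  ip (l1_caputo alpha tau v n) z =
  \sum_(i < n.+1) l1_coef alpha tau i.+1 *
    (ip (shifted_midpoint v (n.+1 - i)%N) z -
     ip (shifted_midpoint v (n - i)%N) z).
Proof.
move=> Lv Lz; rewrite l1_caputoE.
pose d i : R -> R :=
  shifted_midpoint v (n.+1 - i)%N - shifted_midpoint v (n - i)%N.
have Ld i : L2 L (d i) by apply: L2_B; apply: Lv; lia.
have := @inner_suml R L M L_gt0 M_gt0 n.+1
  (fun i => l1_coef alpha tau i.+1 *: d i) z _ Lz.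
case=> [i _|_ ->]; first exact: L2_Z.
apply: eq_bigr => i _; rewrite innerZl// innerBl//; apply: Lv; lia.
Qed.

(** Discrete analogue of (D v, v) >= D |v|^2 / 2. The test function is entry n+1 of the shifted
    sequence, so [discrete_chain_rule] applies with c i its product with entry i. *)
Lemma inner_l1_caputo_ge alpha tau (v : nat -> R -> R) n :
    0 < alpha -> alpha < 1 ->
    (forall i, (i <= n.+1)%N -> L2 L (shifted_midpoint v i)) ->
  forall q : nat -> R,
    (forall i, q i = ip (shifted_midpoint v i) (shifted_midpoint v i)) ->
  2^-1 * \sum_(i < n.+1)
    l1_coef alpha tau i.+1 * (q (n.+1 - i)%N - q (n - i)%N) <=
  ip (l1_caputo alpha tau v n) (midpoint v n).
Proof.
move=> a0 a1 Lv q qE; rewrite inner_l1_caputo//; last exact: (Lv n.+1).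
apply: (@discrete_chain_rule R (fun i => l1_coef alpha tau i.+1)
  (fun i => ip (shifted_midpoint v i) (midpoint v n)) q) => //.
- by move=> i; exact: l1_coef_ge0.
- by move=> i; exact: l1_coef_nonincreasing.
(* For e = 1/2, Young's inequality bounds the product by the mean of the two squared norms; the gap
   is half a squared distance. *)
- move=> i ni; have h2 : 0 < 2^-1 :> R by rewrite invr_gt0.
  have := @inner_young R L M L_gt0 M_gt0 2^-1 _ _
    h2 (Lv _ (leqW ni)) (Lv _ (leqnn _)).
  rewrite !qE [shifted_midpoint v n.+1]/(midpoint v n).
  rewrite (_ : 4 * 2^-1 = 2 :> R); last by field.
  lra.
Qed.

End scheme.

(** * Energy estimate for one time step, and its summation in time *)

Theorem theorem3p1 (R : realType)
    (alpha L T lambda1 lambda2 gamma1 gamma2 : R)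
    (M N k : nat) (sigma : nat -> R)
    (f : R -> R -> R) (u : nat -> R -> R)
    (halpha0 : 0 < alpha) (halpha1 : alpha < 1) (hL : 0 < L) (hT : 0 < T)
    (hlambda1 : 0 < lambda1) (hlambda2 : 0 < lambda2)
    (hgamma1 : 0 < gamma1) (hgamma2 : 0 < gamma2)
    (hM : (0 < M)%N) (hN : (0 < N)%N) (hk : (1 <= k)%N)
    (hsigma : forall m, (m <= M)%N -> 0 < sigma m)
    (hf : C0_L2 L T f)
    (hu : cn_l1_nipg_solution alpha L T lambda1 lambda2 gamma1 gamma2
            M N k sigma f u) :
  forall n, (n < N)%N ->
    L2norm L (u n.+1) ^+ 2 <=
      (1 + lambda2 / lambda1 * omega (2 - alpha) (time_node T N n.+1))
        * L2norm L (u 0%N) ^+ 2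
      + time_step T N / (2 * lambda1 * gamma2)
        * \sum_(j < n.+1)
            L2norm L (midpoint (fun i => f (time_node T N i)) j) ^+ 2.
Proof.
case: hu => u_dg u_scheme.
set tau := time_step T N; set fn := fun i => f (time_node T N i).
have N0 : 0 < N%:R :> R by rewrite ltr0n.
have tau0 : 0 < tau by rewrite divr_gt0.
have u_L2 i : (i <= N)%N -> L2 L (u i) by move=> /u_dg /dg_space_L2.
have fn_L2 i : (i <= N)%N -> L2 L (fn i).
  move=> iN; apply: hf.1; apply/andP; split; first by rewrite mulr_ge0// ltW.
  rewrite /time_node -[leRHS](divfK (lt0r_neq0 N0)) mulrC.
  by rewrite ler_wpM2l ?ler_nat// ltW.
have mid_L2 (v : nat -> R -> R) i :
    (forall i, (i <= N)%N -> L2 L (v i)) -> (i < N)%N -> L2 L (midpoint v i).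
  by move=> vL iN; apply/L2_Z/L2_D; apply: vL => //; exact: ltnW.
have sh_L2 i : (i <= N)%N -> L2 L (shifted_midpoint u i).
  by case: i => [|i] iN; [exact: u_L2|exact: mid_L2].
pose Q i := inner L M (u i) (u i).
pose q i := inner L M (shifted_midpoint u i) (shifted_midpoint u i).
pose F i := inner L M (midpoint fn i) (midpoint fn i).
pose d i := l1_coef alpha tau i.
pose S n := \sum_(i < n.+1) d i.+1 * (q (n.+1 - i)%N - q (n - i)%N).
have energy n : (n < N)%N ->
    Q n.+1 - Q n + tau * lambda2 / lambda1 * S n <=
    tau / (2 * lambda1 * gamma2) * F n.
  move=> nN; have Lw := mid_L2 u n u_L2 nN.
  have Lu := u_L2 _ (ltnW nN); have LuS := u_L2 _ nN.
  pose w := midpoint u n; pose B := nipg_form L M gamma1 gamma2 sigma w w.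
  pose D := inner L M (l1_caputo alpha tau u n) w.
  have hD : 2^-1 * S n <= D.
    apply: inner_l1_caputo_ge => // i iN.
    by apply: sh_L2; exact: leq_trans iN nN.
  (* The choice e = [gamma2] makes the first term exactly what coercivity provides in [hB]. *)
  have hI : inner L M (midpoint fn n) w <=
      gamma2 * inner L M w w + F n / (4 * gamma2).
    by apply: inner_young => //; exact: mid_L2.
  have hB : gamma2 * inner L M w w <= B.
    apply: nipg_form_coercive => // [|m mM]; first exact: ltW.
    exact: ltW (hsigma _ mM).
  (* A difference paired with a half-sum: the cross terms cancel by symmetry. *)
  have hQ : inner L M (tau^-1 *: (u n.+1 - u n)) w =
      tau^-1 * ((Q n.+1 - Q n) / 2).
    rewrite (innerZl hL hM tau^-1)//; last exact: L2_B.
    congr (_ * _); rewrite innerC (innerZl hL hM 2^-1)//;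
      [|exact: L2_D|exact: L2_B].
    rewrite innerDl//; last exact: L2_B.
    rewrite ![inner _ _ _ (_ - _)]innerC !innerBl//.
    rewrite [inner _ _ (u n.+1) (u n)]innerC.
    by rewrite /Q; lra.
  have hE : lambda1 * (tau^-1 * ((Q n.+1 - Q n) / 2)) + lambda2 * D + B =
      inner L M (midpoint fn n) w.
    rewrite -hQ; apply: u_scheme => //.
    by apply: dg_space_midpoint; apply: u_dg => //; exact: ltnW.
  have h0 : 0 <= F n / (4 * gamma2) - lambda1 * (tau^-1 * ((Q n.+1 - Q n) / 2))
      - lambda2 * (2^-1 * S n).
    by have := ler_wpM2l (ltW hlambda2) hD; lra.
  (* The factor 2 tau / lambda1 normalizes the coefficient of [Q n.+1 - Q n] to 1 and turns 1 / (4
     gamma2) into tau / (2 lambda1 gamma2). *)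
  rewrite -subr_ge0; have c0 : 0 <= 2 * tau / lambda1.
    by apply: divr_ge0; [apply: mulr_ge0 => //|]; exact: ltW.
  have := mulr_ge0 c0 h0; congr (0 <= _).
  by field; rewrite !gt_eqF.
have Q0 : q 0%N = Q 0%N by [].
have q_ge0 i : 0 <= q i by exact: inner_ge0.
have S_sum n : - (tau `^ (- alpha) * omega (2 - alpha) n%:R) * Q 0%N <=
    \sum_(m < n) S m.
  rewrite [leRHS](double_sum_telescope (fun i => d i.+1) q n).
  rewrite -sum_l1_coef// mulNr mulr_suml -sumrN.
  apply: ler_sum => i _; rewrite -mulrN ler_wpM2l ?l1_coef_ge0//.
  by rewrite -Q0 lerBrDl subrr.
(* Homogeneity of degree 1 - alpha: tau tau^(-alpha) = tau^(1 - alpha) is absorbed into the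
   argument, giving t_n = n tau. *)
have scaling n : tau * (tau `^ (- alpha) * omega (2 - alpha) n%:R) =
    omega (2 - alpha) (time_node T N n).
  rewrite /omega /time_node -/tau powRM ?ler0n ?(ltW tau0)// !mulrA.
  congr (_ / _).
  rewrite -[X in X * _ * _ = _](powRr1 (ltW tau0)) -powRD.
    2: by rewrite (gt_eqF tau0) implybT.
  by rewrite mulrC; congr (_ * _ `^ _); lra.
move=> n nN; rewrite !(L2norm_sqr hL hM)// -?/(Q _); [|exact: u_L2..].
under [X in _ + _ * X]eq_bigr => j _.
  rewrite (L2norm_sqr hL hM)//; last first.
    by apply: mid_L2 => //; have := ltn_ord j; lia.
  over.
have summed m : (m <= N)%N ->
    Q m - Q 0%N + tau * lambda2 / lambda1 * \sum_(i < m) S i <=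
    tau / (2 * lambda1 * gamma2) * \sum_(i < m) F i.
  elim: m => [_|m IH mN]; first by rewrite !big_ord0; lra.
  rewrite !big_ord_recr/= !mulrDr.
  by have := IH (ltnW mN); have := energy m mN; lra.
have := summed _ nN; rewrite -/tau -/fn -scaling => h.
have k0 : 0 <= tau * lambda2 / lambda1 
  by apply: divr_ge0; [apply: mulr_ge0|]; exact: ltW.
have := ler_wpM2l k0 (S_sum n.+1).
(* Generalizing the powers and the sum of the [S i] leaves a purely algebraic inequality; the last
   rewriting exposes the product bounded by [S_sum]. *)
move: h; rewrite -/(Q n.+1) -/(Q 0%N); move: (omega _ _) (tau `^ _) => o t.
move: (\sum_(i < n.+1) S i) => s h1 h2.
rewrite mulrDl mul1r.
have -> : lambda2 / lambda1 * (tau * (t * o)) * Q 0%N =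
  - (tau * lambda2 / lambda1 * (- (t * o) * Q 0%N)) by ring.
by move: h1 h2; rewrite /F; lra.
Qed.
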